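(* Let $X,Y$ be normed spaces, let $\varphi:X\times Y\to(-\infty,\infty]$ and $G:X\rightrightarrows Y$, and let $\mu(x)=\inf\{\varphi(x,y)\mid y\in G(x)\}$ and $M(x)=\{y\in G(x)\mid \varphi(x,y)=\mu(x)\}$. Let $\mu$ be finite at some $\bar x\in\operatorname{dom}M$, and let $\bar y\in M(\bar x)$. The following assertions hold. (i) If $\widehat\partial^{+}\varphi(\bar x,\bar y)\neq\emptyset$, then $$\widehat\partial\mu(\bar x)\subset\bigcap_{(x^*,y^* )\in\widehat\partial^{+}\varphi(\bar x,\bar y)}\big[x^*+\widehat D^*G(\bar x,\bar y)(y^* )\big].$$ (ii) We have $$\widehat\partial\mu(\bar x)\supset\bigcup_{(x^*,y^* )\in\widehat\partial\varphi(\bar x,\bar y)}\big[x^*+\widehat D^*G(\bar x,\bar y)(y^* )\big]$$ provided that at least one of the following conditions holds: (a) $G$ is semilocally nearly-isolated calm at $(\bar x,\bar y)$. (b) $G$ is locally nearly-isolated calm at $(\bar x,\bar y)$, and for every $\varepsilon>0$ there exists $\gamma>0$ such that $$\mu(x)=\inf_{y\in G(x)}\varphi(x,y)=\inf_{y\in G(x)\cap\mathbb B(\bar y,\varepsilon)}\varphi(x,y)\quad\text{for all }x\in\mathbb B(\bar x,\gamma).$$ (c) The solution mapping $M:\operatorname{dom}G\rightrightarrows Y$ admits an upper Lipschitzian selection at $(\bar x,\bar y)$.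
   Context: All spaces are normed; $X^*$ is the topological dual of $X$; $\mathbb B(\bar x,r)$ is the open ball, $\overline{\mathbb B}_Y$ is the closed unit ball of $Y$; product spaces carry the norm $\|(x,y)\|=\|x\|+\|y\|$. For $F:X\rightrightarrows Y$, $\operatorname{dom}F=\{x\mid F(x)\neq\emptyset\}$ and $\operatorname{gph}F=\{(x,y)\mid y\in F(x)\}$. The infimum over the empty set is $+\infty$. Regular subdifferential: for an extended-real-valued $f$ on a normed space $Z$ finite at $\bar z$, $\widehat\partial f(\bar z)$ is the set of $z^*\in Z^*$ such that for every $\varepsilon>0$ there is $\gamma>0$ with $f(z)-f(\bar z)-\langle z^*,z-\bar z\rangle\ge-\varepsilon\|z-\bar z\|$ for all $z\in\mathbb B(\bar z,\gamma)$. Upper regular subdifferential: $\widehat\partial^{+}f(\bar z):=-\widehat\partial(-f)(\bar z)$. Regular normal cone: for $S\subset Z$ and $\bar z\in S$, $\widehat N(\bar z;S)=\{z^*\in Z^*\mid \limsup_{z\to\bar z,\,z\in S}\langle z^*,\frac{z-\bar z}{\|z-\bar z\|}\rangle\le0\}$. Regular coderivative: for $(\bar x,\bar y)\in\operatorname{gph}G$ and $y^*\in Y^*$, $\widehat D^*G(\bar x,\bar y)(y^* )=\{x^*\in X^*\mid (x^*,-y^* )\in\widehat N((\bar x,\bar y);\operatorname{gph}G)\}$. Nearly-isolated calmness at $(\bar x,\bar y)\in\operatorname{gph}F$: $F:X\rightrightarrows Y$ is locally nearly-isolated calm if there are $L>0$, $\gamma>0$ with $F(u)\cap\mathbb B(\bar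 y,\gamma)\subset\{\bar y\}+L\|u-\bar x\|\overline{\mathbb B}_Y$ for all $u\in\mathbb B(\bar x,\gamma)\setminus\{\bar x\}$; it is semilocally nearly-isolated calm if there are $L>0$, $\gamma>0$ with $F(u)\subset\{\bar y\}+L\|u-\bar x\|\overline{\mathbb B}_Y$ for all $u\in\mathbb B(\bar x,\gamma)\setminus\{\bar x\}$. Upper Lipschitzian selection: a set-valued mapping $F:D\rightrightarrows Y$, $D\subset X$, admits an upper Lipschitzian selection at $(\bar x,\bar y)\in\operatorname{gph}F$ if there is a single-valued $h:D\to Y$ with $h(\bar x)=\bar y$, $h(x)\in F(x)$ for all $x\in D$ in a neighborhood of $\bar x$, and $h$ calm at $\bar x$, i.e., there are $r>0$, $\ell\ge0$ with $\|h(x)-h(\bar x)\|\le\ell\|x-\bar x\|$ for all $x\in\mathbb B(\bar x,r)\cap D$. *)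

(* Defs.v *)
From HB Require Import structures.
From mathcomp Require Import all_boot all_order all_algebra.
From mathcomp Require Import all_classical all_reals all_analysis.
Set Implicit Arguments.
Unset Strict Implicit.
Unset Printing Implicit Defensive.
Import Order.TTheory GRing.Theory Num.Theory.
Import numFieldNormedType.Exports.
Local Open Scope classical_set_scope.
Local Open Scope ring_scope.

(* The library norms X * Y with the maximum norm; [sumprod X Y] is the same
   vector space with the norm `|x| + `|y|. *)
Definition sumprod (R : realType) (X Y : normedModType R) : Type := (X * Y)%type.

Section SumProd.
Context (R : realType) (X Y : normedModType R).

HB.instance Definition _ := GRing.Lmodule.copy (sumprod X Y) (X * Y)%type.

Definition sumnorm (z : sumprod X Y) : R := `|z.1| + `|z.2|.

Lemma sumnormD (z w : sumprod X Y) : sumnorm (z + w) <= sumnorm z + sumnorm w.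
Proof. by rewrite /sumnorm addrACA lerD// ler_normD. Qed.

Lemma sumnormZ (a : R) (z : sumprod X Y) : sumnorm (a *: z) = `|a| * sumnorm z.
Proof. by rewrite /sumnorm !normrZ mulrDr. Qed.

Lemma sumnorm0_eq0 (z : sumprod X Y) : sumnorm z = 0 -> z = 0.
Proof.
case: z => x y /eqP; rewrite /sumnorm /= paddr_eq0// !normr_eq0.
by move=> /andP[/eqP -> /eqP ->].
Qed.

HB.instance Definition _ := @Lmodule_isNormed.Build R (sumprod X Y)
  sumnorm sumnormD sumnormZ sumnorm0_eq0.

End SumProd.

Section Dual.
Context (R : realType) (Z : normedModType R).

Definition dual_pred : {pred Z -> R} :=
  fun f => `[< scalar f /\ continuous f >].

Lemma dual_submod_closed : submod_closed dual_pred.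
Proof.
split => [|a f g].
  apply/asboolP; split; last exact: cst_continuous.
  by move=> b u v; rewrite (_ : forall w, (0 : Z -> R) w = 0)// !mulr0 addr0.
move=> /asboolP[lf cf] /asboolP[lg cg]; apply/asboolP; split.
  have E w : (a *: f + g) w = a * f w + g w by [].
  move=> b u v; rewrite !E lf lg /= !mulrDr -!addrA mulrCA.
  by congr (_ + _); rewrite addrCA.
by move=> x; apply: cvgD; [apply: cvgZl_tmp; exact: cf|exact: cg].
Qed.

HB.instance Definition _ := GRing.isSubmodClosed.Build R (Z -> R)
  dual_pred dual_submod_closed.

Record dual : Type := Dual { dual_fun :> Z -> R ; dual_funP : dual_fun \in dual_pred }.

HB.instance Definition _ := [isSub for dual_fun].
HB.instance Definition _ := [Choice of dual by <:].
HB.instance Definition _ := [SubChoice_isSubLmodule of dual by <:].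

End Dual.

Section DualPair.
Context (R : realType) (X Y : normedModType R).

Definition dual_pair_fun (p : dual X * dual Y) : sumprod X Y -> R :=
  fun z => p.1 z.1 + p.2 z.2.

Lemma dual_pair_subproof (p : dual X * dual Y) :
  dual_pair_fun p \in @dual_pred R (sumprod X Y).
Proof.
case: p => -[f pf] [g pg].
have /asboolP[lf cf] := pf; have /asboolP[lg cg] := pg; apply/asboolP; split.
  move=> b u v; rewrite /dual_pair_fun /= lf lg /= mulrDr -!addrA.
  by congr (_ + _); rewrite addrCA.
have cfst : continuous (fun z : sumprod X Y => z.1).
  move=> z; apply/(@cvgrPdist_lt _ _ _ (nbhs z)) => e e0; near=> t.
  apply: (@le_lt_trans _ _ `|z - t|); first by rewrite lerDl.
  by near: t; apply: cvgr_dist_lt.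
have csnd : continuous (fun z : sumprod X Y => z.2).
  move=> z; apply/(@cvgrPdist_lt _ _ _ (nbhs z)) => e e0; near=> t.
  apply: (@le_lt_trans _ _ `|z - t|); first by rewrite lerDr.
  by near: t; apply: cvgr_dist_lt.
have cf1 z : f w.1 @[w --> (z : sumprod X Y)] --> f z.1.
  exact: (@continuous_comp (sumprod X Y) X R^o fst f z (cfst z) (cf _)).
have cg2 z : g w.2 @[w --> (z : sumprod X Y)] --> g z.2.
  exact: (@continuous_comp (sumprod X Y) Y R^o snd g z (csnd z) (cg _)).
by move=> z; exact: (cvgD (cf1 z) (cg2 z)).
Unshelve. all: by end_near. Qed.

(* The identification of X^* x Y^* with the dual of the product. *)
Definition dual_pair (p : dual X * dual Y) : dual (sumprod X Y) :=
  Dual (dual_pair_subproof p).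

End DualPair.

Section Subdifferentials.
Context (R : realType) (Z : normedModType R).
Implicit Types (f : Z -> \bar R) (z : Z) (S : set Z).

(* Both subdifferentials are empty where [f] is not finite. *)
Definition regular_subdiff f z : set (dual Z) :=
  [set zs | f z \is a fin_num /\
    forall eps : R, 0 < eps -> exists2 gamma : R, 0 < gamma &
      forall w, ball z gamma w ->
        ((- eps * `|w - z|)%:E <= f w - f z - (zs (w - z))%:E)%E].

Definition upper_regular_subdiff f z : set (dual Z) :=
  [set - zs | zs in regular_subdiff (fun w => - f w)%E z].

(* The quotient is tested along points [w] of [S] tending to [z], with
   [w != z]; at an isolated point of [S] the limsup is -oo. *)
Definition regular_normal_cone z S : set (dual Z) :=
  [set zs | (limf_esup (fun w => (zs (`|w - z|^-1 *: (w - z)))%:E)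
               (within S z^') <= 0)%E].

End Subdifferentials.

Section Mappings.
Context (R : realType) (X Y : normedModType R).
Implicit Types (F G : X -> set Y) (D : set X) (x : X) (y : Y).

Definition dom G : set X := [set x | G x !=set0].

Definition gph G : set (sumprod X Y) := [set z | G z.1 z.2].

Definition regular_coderivative G x y (ys : dual Y) : set (dual X) :=
  [set xs | regular_normal_cone ((x, y) : sumprod X Y) (gph G)
              (dual_pair (xs, - ys))].

Definition calm_ball (L : R) x y (u : X) : set Y :=
  [set y + (L * `|u - x|) *: b | b in closed_ball_ Num.norm (0 : Y) 1].

Definition locally_nearly_isolated_calm F x y :=
  exists L gamma : R, [/\ 0 < L, 0 < gamma &
    forall u, (ball x gamma `\ x) u ->
      F u `&` ball y gamma `<=` calm_ball L x y u].

Definition semilocally_nearly_isolated_calm F x y :=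
  exists L gamma : R, [/\ 0 < L, 0 < gamma &
    forall u, (ball x gamma `\ x) u -> F u `<=` calm_ball L x y u].

(* A selection h : D -> Y is given by a function on X, of which only the
   values on D matter. *)
Definition upper_lipschitzian_selection D F x y :=
  exists h : X -> Y, [/\ h x = y,
    (\forall u \near x, D u -> F u (h u)) &
    exists r l : R, [/\ 0 < r, 0 <= l &
      forall u, (ball x r `&` D) u -> `|h u - h x| <= l * `|u - x|]].

Variables (phi : sumprod X Y -> \bar R) (G : X -> set Y).

Definition marginal x : \bar R := ereal_inf [set phi (x, y) | y in G x].

Definition solution_map x : set Y :=
  [set y | G x y /\ phi (x, y) = marginal x].

End Mappings.

(* Main.v *)
(** Fix a graph point (x, y) near (xb, yb). Since mu(x) <= phi(x, y), with
    equality at (xb, yb), a lower estimate of mu and an upper estimate of phi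
    combine into an upper estimate of the linear form (us - xs, - ys) on the
    graph of G, which is (i). Conversely, a lower estimate of phi and the normal
    cone inequality bound phi(x, y) from below, with error
    eps (`|x - xb| + `|y - yb|); each of (a), (b), (c) lets mu(x) be
    computed from points y with `|y - yb| <= L `|x - xb|, so that this error is
    at most eps (1 + L) `|x - xb|, which is (ii). *)

Require Import Defs.
From HB Require Import structures.
From mathcomp Require Import all_boot all_order all_algebra.
From mathcomp Require Import all_classical all_reals all_analysis.
From mathcomp Require Import ring lra.
Set Implicit Arguments.
Unset Strict Implicit.
Unset Printing Implicit Defensive.
Import Order.TTheory GRing.Theory Num.Theory.
Import numFieldNormedType.Exports.
Local Open Scope classical_set_scope.
Local Open Scope ring_scope.

Section DualTheory.
Context (R : realType) (Z : normedModType R).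
Implicit Types (f g : dual Z) (u v : Z).

Lemma dual_scalar f : scalar f.
Proof. by have /asboolP[] := dual_funP f. Qed.

HB.instance Definition _ f :=
  GRing.isLinear.Build R Z R *%R (dual_fun f) (dual_scalar f).

Lemma dualDE f g u : (f + g) u = f u + g u.
Proof. by []. Qed.

Lemma dualNE f u : (- f) u = - f u.
Proof. by []. Qed.

End DualTheory.

Section EpsilonCharacterizations.
Context (R : realType) (Z : normedModType R).
Implicit Types (f : Z -> \bar R) (z : Z) (S : set Z) (zs : dual Z).

(** Finiteness of [f z] allows all real terms to be moved to one side, also when [f w] is infinite.
    With [f w] isolated, estimates chain by transitivity in the extended reals. *)
Lemma regular_subdiffP f z zs : f z \is a fin_num ->
  regular_subdiff f z zs <->
  forall eps : R, 0 < eps -> exists2 gamma : R, 0 < gamma &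
    forall w, ball z gamma w ->
      ((fine (f z) + zs (w - z) - eps * `|w - z|)%:E <= f w)%E.
Proof.
move=> fz; have lower (a : \bar R) (b c d : R) :
    ((- c)%:E <= a - b%:E - d%:E)%E = ((b + d - c)%:E <= a)%E.
  case: a => [a| |] /=; rewrite ?lee_fin ?leey//.
  by apply/idP/idP => ?; lra.
split=> [[_ h]|h].
  move=> e /h[g g0 {}h]; exists g => // w /h.
  by rewrite -{1}(fineK fz) mulNr lower.
split=> // e /h[g g0 {}h]; exists g => // w /h.
by rewrite -{2}(fineK fz) mulNr lower.
Qed.

Lemma upper_regular_subdiffP f z zs : f z \is a fin_num ->
  upper_regular_subdiff f z zs <->
  forall eps : R, 0 < eps -> exists2 gamma : R, 0 < gamma &
    forall w, ball z gamma w ->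
      (f w <= (fine (f z) + zs (w - z) + eps * `|w - z|)%:E)%E.
Proof.
move=> fz; have Nfz : (- f z)%E \is a fin_num by rewrite fin_numN.
have upper w (c : R) : ((fine (- f z) + (- zs) (w - z) - c)%:E <= - f w)%E =
    (f w <= (fine (f z) + zs (w - z) + c)%:E)%E.
  rewrite leeNr -EFinN fineN dualNE; congr (_ <= _%:E)%E; lra.
split=> [[vs hvs <-{zs upper}]|h].
  have /(regular_subdiffP _ Nfz) h := hvs.
  move=> e /h[g g0 {}h]; exists g => // w /h.
  rewrite leeNr -EFinN fineN dualNE => /le_trans; apply.
  by rewrite lee_fin; lra.
exists (- zs); last exact: opprK.
apply/regular_subdiffP => // e /h[g g0 {}h]; exists g => // w /h.
by rewrite upper.
Qed.

(** Multiplying the quotient by [|w - z|] removes the normalization; at [w = z] both sides vanish,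
    so the punctured neighbourhood becomes a full ball. *)
Lemma regular_normal_coneP z S zs :
  regular_normal_cone z S zs <->
  forall eps : R, 0 < eps -> exists2 gamma : R, 0 < gamma &
    forall w, ball z gamma w -> S w -> zs (w - z) <= eps * `|w - z|.
Proof.
split=> [h e e0|h].
  have /ereal_inf_lt[_ [V zV <-] Ve] := le_lt_trans h (e0 : (0 < e%:E)%E).
  have /nbhs_ballP[g g0 gV] := zV; exists g => // w zw Sw.
  have [->|wz] := eqVneq w z; first by rewrite subrr linear0 normr0 mulr0.
  have /= Vw := gV w zw wz Sw.
  have : ((zs (`|w - z|^-1 *: (w - z)))%:E <= e%:E)%E.
    by apply: le_trans (ltW Ve); apply: ereal_sup_ubound; exists w.
  by rewrite lee_fin linearZ/= ler_pdivrMl ?normr_gt0 ?subr_eq0// mulrC.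
apply/lee_addgt0Pr => e e0; rewrite add0e.
have [g g0 {}h] := h e e0.
(* The limsup is an infimum of suprema over the sets of the filter, so one set whose supremum is at
   most [e] suffices. *)
apply: ge_ereal_inf.
exists (ereal_sup [set (zs (`|w - z|^-1 *: (w - z)))%:E | w in
    [set w | [/\ ball z g w, w != z & S w]]]).
  exists [set w | [/\ ball z g w, w != z & S w]] => //.
  by apply/nbhs_ballP; exists g => //= w zw wz Sw.
apply: ge_ereal_sup => _ [w [zw wz Sw] <-].
by rewrite lee_fin linearZ/= ler_pdivrMl ?normr_gt0 ?subr_eq0// mulrC h.
Qed.

End EpsilonCharacterizations.

Section MarginalSubdifferential.
Context (R : realType) (X Y : normedModType R).
Variables (phi : sumprod X Y -> \bar R) (G : X -> set Y).
Implicit Types (x : X) (y : Y) (xs us : dual X) (ys : dual Y).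

Lemma norm_sumprod (z : sumprod X Y) : `|z| = `|z.1| + `|z.2|.
Proof. by []. Qed.

Lemma dual_pairE xs ys (z : sumprod X Y) :
  dual_pair (xs, ys) z = xs z.1 + ys z.2.
Proof. by []. Qed.

Lemma ball_sumprod x y (r : R) (w : sumprod X Y) :
  ball ((x, y) : sumprod X Y) r w = (`|w.1 - x| + `|w.2 - y| < r) :> Prop.
Proof. by rewrite -ball_normE /= norm_sumprod /= distrC (distrC y). Qed.

Lemma ball_distC (Z : normedModType R) (z w : Z) (r : R) :
  ball z r w = (`|w - z| < r) :> Prop.
Proof. by rewrite -ball_normE /= distrC. Qed.

Lemma ball_minr (Z : normedModType R) (z w : Z) (r s : R) :
  ball z (Num.min r s) w -> ball z r w /\ ball z s w.
Proof. by rewrite !ball_distC lt_min => /andP. Qed.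

Lemma regular_coderivativeP x y ys xs :
  regular_coderivative G x y ys xs <->
  forall eps : R, 0 < eps -> exists2 gamma : R, 0 < gamma &
    forall u v, `|u - x| + `|v - y| < gamma -> G u v ->
      xs (u - x) - ys (v - y) <= eps * (`|u - x| + `|v - y|).
Proof.
apply: (iff_trans (@regular_normal_coneP R (sumprod X Y) (x, y) (gph G)
  (dual_pair (xs, - ys)))); split=> h e /h[g g0 {}h];
    exists g => //.
  by move=> u v uv Guv; apply: (h (u, v)) => //; rewrite ball_sumprod.
by move=> [u v]; rewrite ball_sumprod => uv Guv; exact: h.
Qed.

Lemma marginal_le x y : G x y -> (marginal phi G x <= phi (x, y))%E.
Proof. by move=> Gxy; apply: ereal_inf_lbound; exists y. Qed.

Variables (xb : X) (yb : Y).
Hypothesis mu_fin : marginal phi G xb \is a fin_num.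
Hypothesis phi_xb : phi (xb, yb) = marginal phi G xb.

Let phi_fin : phi (xb, yb) \is a fin_num. Proof. by rewrite phi_xb. Qed.

Lemma regular_subdiff_marginal_sub xs ys us :
  upper_regular_subdiff phi (xb, yb) (dual_pair (xs, ys)) ->
  regular_subdiff (marginal phi G) xb us ->
  regular_coderivative G xb yb ys (us - xs).
Proof.
move=> /(upper_regular_subdiffP _ phi_fin) hphi.
move=> /(regular_subdiffP _ mu_fin) hmu.
apply/regular_coderivativeP => e e0.
(* The errors of [phi] and of the marginal function add up, and each is at most [e / 2] times the
   product norm. *)
have e20 : 0 < e / 2 by lra.
have [g1 g10 {}hphi] := hphi _ e20; have [g2 g20 {}hmu] := hmu _ e20.
exists (Num.min g1 g2); first by rewrite lt_min g10.
move=> u v; rewrite lt_min => /andP[uv1 uv2] Guv.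
have : ball ((xb, yb) : sumprod X Y) g1 (u, v) by rewrite ball_sumprod.
move=> /hphi h1.
have : ball xb g2 u.
  by rewrite ball_distC; apply: le_lt_trans uv2; rewrite lerDl.
move=> /hmu /le_trans /(_ (marginal_le Guv)) /le_trans /(_ h1).
rewrite phi_xb lee_fin dualDE dualNE dual_pairE norm_sumprod/=.
have := normr_ge0 (v - yb); nra.
Qed.

(* Points [(x, y)] of the graph with [`|y - yb| <= L `|x - xb|] satisfy the
   estimate required of the marginal function; conditions (a), (b) and (c) all
   ensure that the infimum can be restricted to such points. *)
Lemma phi_lower_estimate xs ys us (L eps : R) :
  regular_subdiff phi (xb, yb) (dual_pair (xs, ys)) ->
  regular_coderivative G xb yb ys us -> 0 <= L -> 0 < eps ->
  exists2 gamma : R, 0 < gamma &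
    forall x y, ball xb gamma x -> G x y -> `|y - yb| <= L * `|x - xb| ->
      ((fine (marginal phi G xb) + (xs + us) (x - xb)
        - eps * `|x - xb|)%:E <= phi (x, y))%E.
Proof.
move=> /(regular_subdiffP _ phi_fin) hphi /regular_coderivativeP hG L0 e0.
have L1 : 0 < 1 + L by lra.
(* The subdifferential and the coderivative each cost [d] times the product norm, which is at most
   [(1 + L) * |x - xb|]; the total is [eps * |x - xb|]. *)
pose d := eps / (2 * (1 + L)).
have d0 : 0 < d by rewrite divr_gt0// mulr_gt0.
have dE : 2 * d * (1 + L) = eps by rewrite /d; field; rewrite gt_eqF.
have [g1 g10 {}hphi] := hphi _ d0; have [g2 g20 {}hG] := hG _ d0.
(* Dividing by [1 + L] keeps the pair [(x, y)] within both radii in the product norm. *)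
exists (Num.min g1 g2 / (1 + L)); first by rewrite divr_gt0// lt_min g10.
move=> x y; rewrite ball_distC ltr_pdivlMr// => xg Gxy yL.
have xy : `|x - xb| + `|y - yb| <= `|x - xb| * (1 + L) by lra.
have := le_lt_trans xy xg; rewrite lt_min => /andP[xy1 xy2].
have : ball ((xb, yb) : sumprod X Y) g1 (x, y) by rewrite ball_sumprod.
move=> /hphi; apply: le_trans.
rewrite phi_xb lee_fin dualDE dual_pairE norm_sumprod/=.
(* The coderivative inequality bounds [ys (y - yb)] below by [us (x - xb)] up to the error. *)
have := hG _ _ xy2 Gxy.
have := ler_wpM2l (ltW d0) xy; rewrite -dE; nra.
Qed.

Lemma calm_ball_norm (L : R) x y : 0 <= L -> calm_ball L xb yb x y ->
  `|y - yb| <= L * `|x - xb|.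
Proof.
move=> L0 [b]; rewrite /closed_ball_ /= sub0r normrN => b1 <-.
rewrite addrC addKr normrZ ger0_norm ?mulr_ge0//.
by rewrite ler_piMr ?mulr_ge0.
Qed.

(** Isolates what (a), (b) and (c) share: a minorant [c] of [phi] on the calm part of the graph
    passes to the marginal function. Only [x != xb] is asked for, as in isolated calmness; at [xb]
    the required estimate is an equality. *)
Lemma regular_subdiff_marginal_calm (L : R) xs ys us : 0 <= L ->
  (forall c : X -> R, (exists2 gamma : R, 0 < gamma &
      forall x y, ball xb gamma x -> G x y -> `|y - yb| <= L * `|x - xb| ->
        ((c x)%:E <= phi (x, y))%E) ->
    exists2 gamma : R, 0 < gamma & forall x, ball xb gamma x -> x != xb ->
      ((c x)%:E <= marginal phi G x)%E) ->
  regular_subdiff phi (xb, yb) (dual_pair (xs, ys)) ->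
  regular_coderivative G xb yb ys us ->
  regular_subdiff (marginal phi G) xb (xs + us).
Proof.
move=> L0 restrict hphi hG; apply/(regular_subdiffP _ mu_fin) => e e0.
have /restrict[g g0 h] :=
  phi_lower_estimate hphi hG L0 e0.
exists g => // x xg; have [->|] := eqVneq x xb; last exact: h.
by rewrite subrr linear0 normr0 mulr0 addr0 subr0 fineK.
Qed.

Lemma regular_subdiff_marginal_sup xs ys us :
  [\/ semilocally_nearly_isolated_calm G xb yb,
      locally_nearly_isolated_calm G xb yb /\
        (forall eps : R, 0 < eps -> exists2 gamma : R, 0 < gamma &
          forall x, ball xb gamma x ->
            marginal phi G x
            = ereal_inf [set phi (x, y) | y in G x `&` ball yb eps])
    | upper_lipschitzian_selection (dom G) (solution_map phi G) xb yb] ->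
  regular_subdiff phi (xb, yb) (dual_pair (xs, ys)) ->
  regular_coderivative G xb yb ys us ->
  regular_subdiff (marginal phi G) xb (xs + us).
Proof.
case=> [[L [g [L0 g0 calm]]]|[[L [g [L0 g0 calm]]] loc]|].
- apply: (@regular_subdiff_marginal_calm L); first exact: ltW.
  move=> c [d d0 h]; exists (Num.min g d); first by rewrite lt_min g0.
  move=> x /ball_minr[xg xd] xxb.
  apply: le_ereal_inf_tmp => _ [y Gxy <-]; apply: h => //.
  apply: calm_ball_norm; first exact: ltW.
  by apply: calm Gxy; split=> //; exact/eqP.
(* Localizing at the calmness radius [g] leaves in the infimum only values [y] that calmness
   controls. *)
- have [g' g'0 {}loc] := loc _ g0.
  apply: (@regular_subdiff_marginal_calm L); first exact: ltW.
  move=> c [d d0 h]; exists (Num.min (Num.min g g') d).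
    by rewrite !lt_min g0 g'0.
  move=> x /ball_minr[/ball_minr[xg xg'] xd] xxb.
  rewrite loc//; apply: le_ereal_inf_tmp => _ [y [Gxy yg] <-]; apply: h => //.
  apply: calm_ball_norm; first exact: ltW.
  by apply: (calm x); [split=> //; exact/eqP|split].
- move=> [k [kxb /nbhs_ballP[g /= g0 kM] [r [L [r0 L0 kL]]]]].
  apply: (@regular_subdiff_marginal_calm L) => //.
  move=> c [d d0 h]; exists (Num.min (Num.min g r) d).
    by rewrite !lt_min g0 r0.
  move=> x /ball_minr[/ball_minr[xg xr] xd] _.
  (* On [dom G] the infimum is attained at [k x], which calmness of the selection keeps near [yb];
     elsewhere it is an infimum over the empty set, hence [+oo]. *)
  have [Gx|Gx] := pselect (dom G x).
    have [Gk <-] := kM x xg Gx.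
    by apply: h => //; rewrite -kxb; exact: kL.
  by apply: le_ereal_inf_tmp => _ [y Gxy <-]; case: Gx; exists y.
Qed.

End MarginalSubdifferential.

Theorem theorem3p3 (R : realType) (X Y : normedModType R)
    (phi : sumprod X Y -> \bar R) (G : X -> set Y) (xb : X) (yb : Y)
    (phi_gtNy : forall z, (-oo < phi z)%E)
    (mu_fin : marginal phi G xb \is a fin_num)
    (dom_xb : dom (solution_map phi G) xb)
    (M_yb : solution_map phi G xb yb) :
  (upper_regular_subdiff phi (xb, yb) !=set0 ->
    regular_subdiff (marginal phi G) xb `<=`
      \bigcap_(p in [set p | upper_regular_subdiff phi (xb, yb) (dual_pair p)])
        [set p.1 + us | us in regular_coderivative G xb yb p.2])
  /\
  ([\/ semilocally_nearly_isolated_calm G xb yb,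
       locally_nearly_isolated_calm G xb yb /\
         (forall eps : R, 0 < eps -> exists2 gamma : R, 0 < gamma &
           forall x, ball xb gamma x ->
             marginal phi G x
             = ereal_inf [set phi (x, y) | y in G x `&` ball yb eps])
     | upper_lipschitzian_selection (dom G) (solution_map phi G) xb yb] ->
    \bigcup_(p in [set p | regular_subdiff phi (xb, yb) (dual_pair p)])
        [set p.1 + us | us in regular_coderivative G xb yb p.2]
      `<=` regular_subdiff (marginal phi G) xb).
Proof.
have [_ phi_xb] := M_yb; split.
  move=> _ us hus -[xs ys] hphi; exists (us - xs); last exact: subrKC.
  exact: (regular_subdiff_marginal_sub mu_fin phi_xb hphi hus).
move=> cond zs [[xs ys] hphi [us hus <-]].
exact: (regular_subdiff_marginal_sup mu_fin phi_xb cond hphi hus).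
Qed.
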